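(* Let $\mathfrak{n}$ be the least cardinal such that every infinite precompact abelian group admits an infinite quotient group of weight at most $\mathfrak{n}$. If $2^{<\mathfrak{c}}=\mathfrak{c}$, then $\mathfrak{n}=2^{\mathfrak{c}}$.
   Context: All topological groups are Hausdorff. A topological group $G$ is precompact if for every neighborhood $U$ of the identity there is a finite $F\subseteq G$ with $G=FU$. A quotient group of an abelian topological group $G$ is $G/N$ with the quotient topology, where $N$ is a closed subgroup. The weight $w(X)$ of a space $X$ is the least cardinality of a base of $X$. $\mathfrak{c}=2^\omega$ and $2^{<\mathfrak{c}}=\sup\{2^\mu:\mu<\mathfrak{c}\}$. *)

(* Defs.v *)
From HB Require Import structures.
From mathcomp Require Import all_boot all_order all_algebra.
From mathcomp Require Import boolp classical_sets functions cardinality.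
From mathcomp Require Import topology normedtype.

Set Implicit Arguments.
Unset Strict Implicit.
Unset Printing Implicit Defensive.

Import GRing.Theory.

Local Open Scope classical_set_scope.
Local Open Scope card_scope.
Local Open Scope ring_scope.

(** Cardinals are represented by types, up to bijection. *)

Definition card_leq (K L : Type) : Prop := [set: K] #<= [set: L].

Definition card_equal (K L : Type) : Prop := [set: K] #= [set: L].

Definition card_less (K L : Type) : Prop := card_leq K L /\ ~ card_equal K L.

(** [set K] is the type of all subsets of [K]. *)
Definition card_pow2 (K : Type) : Type := set K.

Definition continuum : Type := card_pow2 nat.

(** Read "[K] is the least cardinal satisfying [P]"; it determines [K] up to
    bijection. *)
Definition is_least_cardinal (P : Type -> Prop) (K : Type) : Prop :=
  P K /\ forall L : Type, P L -> card_leq K L.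

Definition is_card_sup (P : Type -> Prop) (K : Type) : Prop :=
  is_least_cardinal (fun U => forall L : Type, P L -> card_leq L U) K.

(** Read "[K] is [2^{<L}]". *)
Definition is_weak_pow2 (L K : Type) : Prop :=
  is_card_sup (fun N => exists2 M : Type, card_less M L
                                        & card_equal N (card_pow2 M)) K.

Definition is_weight (X : topologicalType) (K : Type) : Prop :=
  is_least_cardinal
    (fun L => exists2 B : set (set X), basis B & B #= [set: L]) K.

Definition weight_at_most (X : topologicalType) (K : Type) : Prop :=
  exists2 w : Type, is_weight X w & card_leq w K.

Definition precompact_group (G : topologicalZmodType) : Prop :=
  forall U : set G, nbhs 0 U ->
    exists2 F : set G, finite_set F & [set: G] = [set f + u | f in F & u in U].

Definition quotient_group (G : topologicalZmodType) (N : zmodClosed G) :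
  topologicalType := quotient_topology (Quotient.quot N).

Definition has_infinite_quotient_of_weight_at_most
    (G : topologicalZmodType) (K : Type) : Prop :=
  exists N : zmodClosed G,
    [/\ closed [set x : G | x \in N],
        infinite_set [set: quotient_group N]
      & weight_at_most (quotient_group N) K].

(** [K] is least such that every infinite precompact abelian group has an
    infinite quotient group of weight at most [K]. *)
Definition is_frak_n (K : Type) : Prop :=
  is_least_cardinal
    (fun L => forall G : topologicalZmodType,
       hausdorff_space G -> infinite_set [set: G] -> precompact_group G ->
       has_infinite_quotient_of_weight_at_most G L) K.

(* Main.v *)
From Stdlib Require Import Inverse_Image.
From HB Require Import structures.
From mathcomp Require Import all_boot all_algebra.
From mathcomp Require Import wochoice boolp classical_sets functions cardinality.
From mathcomp Require Import topology normedtype.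
Require Import Defs.
Set Implicit Arguments.
Unset Strict Implicit.
Unset Printing Implicit Defensive.
Import GRing.Theory.
Local Open Scope classical_set_scope.
Local Open Scope card_scope.

(** Upper bound.  In an infinite precompact Hausdorff abelian group choose
    neighbourhoods [U_m] of 0 with [U_{m+1} - U_{m+1}] inside [U_m], so small that
    infinitely many points stay distinct modulo [N], the intersection of the [U_m].
    Then [N] is a closed subgroup of infinite index, and since finitely many
    translates of each [U_m] cover the group, a class modulo [N] is determined by a
    sequence of integers.  So [G/N] has at most [c] points, hence at most [2^c]
    open sets, and its weight is at most [2^c].

    Lower bound.  Let [H] be the vector space over the two-element field on a
    set of indices, and let [G] be a group of linear forms on [H], with the
    topology of pointwise convergence on [H]; [G] is precompact and Hausdorff.
    A closed subgroup [N] is the set of forms in [G] that vanish on its annihilator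
    in [H], so if [G/N] is infinite then the annihilator contains a sequence [D] of
    distinct elements.  The set of indices contains, for each sequence [D] in [H],
    [2^c] limit indices [b] attached to [D], and [G] is cut out by the
    conditions [g b = lam_b (g o D)], where [lam_b] is a linear form on the space of
    binary sequences.  Hence all limits of [D] annihilate [N] as well and [G/N] has
    [2^c] continuous characters [g |-> g b]; each basic neighbourhood of 0 lies in
    the kernel of finitely many of them only, so the weight of [G/N] is at least
    [2^c] ([large_weight]).

    What remains is to choose the [lam_b] so that [G] separates the points of [H]
    ([admissible_separates]), for then the characters are pairwise distinct.  Indices
    are well-founded countably branching trees, so a form given on a countable set
    of indices closed under subtrees, and compatible there with the conditions,
    extends by recursion to an element of [G].  Up to isomorphism there are only [c]
    such countable configurations, each with a nonzero vector to be detected.  As in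
    the construction of [2^c] independent functions on a set of size [c], a
    configuration is completed by countably many tests that separate the labels
    of its indices; this lets every label tell, from the configuration alone, which
    position it occupies in it.  Along a well-ordering of type [c] of the completed
    configurations, one chooses for each a form [e] detecting its vector such
    that all sequences [e o D_n] are outside the span of the earlier ones: there
    are [c] candidates for [e], and fewer than [c] are excluded ([generic_family]).
    For a fixed label [x] the sequences [e o D_n], with [n] the position of [x], are
    then linearly independent over all configurations, so that some linear form [lam_x]
    takes the required value [e n] at each of them ([generic_functionals]). *)

(** * Cardinal arithmetic *)

(** [emb A B]: the cardinality of [A] is at most that of [B]. *)
Definition emb (A B : Type) : Prop := exists f : A -> B, injective f.

Lemma emb_trans B A C : emb A B -> emb B C -> emb A C.
Proof. by move=> [f fI] [g gI]; exists (g \o f); exact: inj_comp. Qed.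

Lemma sval_inj (A : Type) (P : A -> Prop) : injective (@sval A P).
Proof. by move=> [a Pa] [b Pb] /= eab; exact: eq_exist. Qed.

Lemma emb_sub (A : Type) (P : A -> Prop) : emb {a | P a} A.
Proof. by exists sval; exact: sval_inj. Qed.

Lemma emb_inl A B : emb A (A + B).
Proof. by exists inl => x y []. Qed.

Lemma emb_inr A B : emb B (A + B).
Proof. by exists inr => x y []. Qed.

Lemma emb_sum A A' B B' : emb A A' -> emb B B' -> emb (A + B) (A' + B').
Proof.
move=> [f fI] [g gI].
exists (fun z => match z with inl a => inl (f a) | inr b => inr (g b) end).
by move=> [a|b] [a'|b'] // [] => [/fI|/gI] ->.
Qed.

Lemma emb_prod A A' B B' : emb A A' -> emb B B' -> emb (A * B) (A' * B').
Proof.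
move=> [f fI] [g gI]; exists (fun z => (f z.1, g z.2)).
by move=> [a b] [a' b'] [/fI -> /gI ->].
Qed.

Lemma emb_fun A A' B : emb A A' -> emb (B -> A) (B -> A').
Proof.
move=> [f fI]; exists (fun h b => f (h b)) => h h' e.
by apply/funext => b; apply: fI; rewrite -[LHS]/((fun b => f (h b)) b) e.
Qed.

Lemma emb_seq A A' : emb A A' -> emb (seq A) (seq A').
Proof. by move=> [f fI]; exists (map f); exact: inj_map. Qed.

Lemma emb_count (T : countType) : emb T nat.
Proof. by exists pickle; exact: (pcan_inj pickleK). Qed.

Lemma card_le_emb (T U : Type) (A : set T) (B : set U) : A #<= B <-> emb A B.
Proof.
split=> [/card_leP/injfunPex[f _ fI]|[f fI]].
  by exists f => x y; apply: fI; rewrite inE.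
by apply/card_leP/injfunPex; exists f => // x y _ _ /fI.
Qed.

Lemma set_type_setT (A : Type) : emb A [set: A] /\ emb [set: A] A.
Proof.
split; last by exists val; exact: val_inj.
by exists (fun a => SigSub (mem_set (I : [set: A] a))) => a b [].
Qed.

Lemma card_leqP A B : card_leq A B <-> emb A B.
Proof.
have [[iA jA] [iB jB]] := (set_type_setT A, set_type_setT B).
rewrite /card_leq card_le_emb; split => h.
  exact: emb_trans iA (emb_trans h jB).
exact: emb_trans jA (emb_trans h iB).
Qed.

(** Any nonempty family of cardinals has a least element: a maximal set of
    choice functions that differ pairwise in every coordinate projects onto some
    coordinate [T i], which then embeds in all the others. *)
Lemma emb_least (I : Type) (T : I -> Type) (i0 : I) :
  exists i, forall j, emb (T i) (T j).
Proof.
pose P (W : set (forall i, T i)) :=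
  forall w w', W w -> W w' -> forall i, w i = w' i -> w = w'.
have [|W [PW maxW]] := @Zorn_bigcup _ P.
  move=> F PF totF w w' [X FX Xw] [Y FY Yw'] i.
  have [XY|YX] := totF _ _ FX FY.
    exact: (PF _ FY) (XY _ Xw) Yw' i.
  exact: (PF _ FX) Xw (YX _ Yw') i.
have [[i Wi]|noti] := pselect (exists i, forall a, exists w, W w /\ w i = a).
  exists i => j; have [h hW] := choice Wi.
  exists (fun a => h a j) => a b /=.
  have [[Wa ha] [Wb hb]] := (hW a, hW b).
  by move=> /(PW _ _ Wa Wb) hab; rewrite -ha -hb hab.
have z i : {a | forall w, W w -> w i <> a}.
  apply/cid; apply: contrapT => na; apply: noti; exists i => a.
  apply: contrapT => nw; apply: na; exists a => w Ww wa; apply: nw.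
  by exists w.
pose w0 i := sval (z i).
exfalso; apply: (maxW (W `|` [set w0])).
  split; first by move=> w; left.
  by move=> /(_ w0 (or_intror erefl)) /(svalP (z i0)); apply.
move=> w w' [Ww|->] [Ww'|->] i.
- exact: PW.
- by move=> e; have := svalP (z i) w Ww e.
- by move=> e; have := svalP (z i) w' Ww' (esym e).
- by [].
Qed.

Lemma emb_total A B : emb A B \/ emb B A.
Proof.
have [[] h] := @emb_least bool (fun b => if b then A else B) true.
  by left; exact: (h false).
by right; exact: (h true).
Qed.

Lemma emb_sum_prod A : emb nat A -> emb (A + A) (A * A).
Proof.
move=> [f fI].
exists (fun z => match z with inl a => (f 0, a) | inr a => (f 1, a) end).
by move=> [a|a] [b|b] [] // => [->|/fI|/fI|->].
Qed.

Lemma emb_square_extend A : emb nat A -> emb (A * A) A ->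
  emb (A * A + (A * A + A * A)) A.
Proof.
move=> nA AA; have SS : emb (A + A) A by exact: emb_trans (emb_sum_prod nA) AA.
apply: emb_trans (emb_sum AA (emb_trans (emb_sum AA AA) SS)) SS.
Qed.

(** An infinite cardinal equals its square.  Zorn's lemma is applied to the graphs
    [W] of injections [D * D -> D], with [D] a subset of [I] read off from the
    diagonal of [W]. *)
Lemma emb_square I : emb nat I -> emb (I * I) I.
Proof.
move=> nI.
pose D (W : set ((I * I) * I)) a := exists c, W ((a, a), c).
pose P (W : set ((I * I) * I)) :=
  [/\ forall p c c', W (p, c) -> W (p, c') -> c = c',
      forall p p' c, W (p, c) -> W (p', c) -> p = p',
      forall a b c, W ((a, b), c) -> [/\ D W a, D W b & D W c] &
      forall a b, D W a -> D W b -> exists c, W ((a, b), c)].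
have [|W [[W1 W2 W3 W4] maxW]] := @Zorn_bigcup _ P.
  move=> F PF totF.
  have join X Y : F X -> F Y ->
      exists Z, [/\ F Z, X `<=` Z & Y `<=` Z].
    by move=> FX FY; have [XY|YX] := totF _ _ FX FY; [exists Y; split|exists X; split].
  split.
  - move=> p c c' [X FX Xp] [Y FY Yp]; have [Z [FZ XZ YZ]] := join X Y FX FY.
    by have [Z1 _ _ _] := PF _ FZ; apply: Z1 (XZ _ Xp) (YZ _ Yp).
  - move=> p p' c [X FX Xp] [Y FY Yp]; have [Z [FZ XZ YZ]] := join X Y FX FY.
    by have [_ Z2 _ _] := PF _ FZ; apply: Z2 (XZ _ Xp) (YZ _ Yp).
  - move=> a b c [X FX Xp]; have [_ _ X3 _] := PF _ FX.
    by have [[x Xx] [y Xy] [z Xz]] := X3 _ _ _ Xp;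
      split; [exists x|exists y|exists z]; exists X.
  - move=> a b [x [X FX Xp]] [y [Y FY Yp]].
    have [Z [FZ XZ YZ]] := join X Y FX FY; have [_ _ _ Z4] := PF _ FZ.
    have [c Zc] := Z4 a b (ex_intro _ x (XZ _ Xp)) (ex_intro _ y (YZ _ Yp)).
    by exists c, Z.
pose DT := {a | D W a}; pose ET := {a | ~ D W a}.
have DD : emb (DT * DT) DT.
  have h (p : DT * DT) : {c : DT | W ((sval p.1, sval p.2), sval c)}.
    apply/cid; case: p => -[a Da] [b Db] /=.
    have [c Wc] := W4 _ _ Da Db; have [_ _ Dc] := W3 _ _ _ Wc.
    by exists (exist _ c Dc).
  exists (fun p => sval (h p)) => p q e.
  have := svalP (h q); rewrite -e => /(W2 _ _ _ (svalP (h p))).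
  by case: p q {e} => [x y] [x' y'] [/= /sval_inj-> /sval_inj->].
have IDE : emb I (DT + ET).
  have h a : exists z : DT + ET, a = match z with inl x => sval x | inr x => sval x end.
    have [Da|Da] := pselect (D W a); first by exists (inl (exist _ a Da)).
    by exists (inr (exist _ a Da)).
  have [g gP] := choice h; exists g => a b e.
  by rewrite (gP a) (gP b) e.
(* If an infinite [A] with [A * A] embedded in [A] and at least as large as the
   domain [D] has a copy [J] outside [D], then [W] extends to [D] plus [J]: the new
   pairs are sent injectively into [J]. *)
have extend (A : Type) : emb nat A -> emb (A * A) A -> emb DT A -> ~ emb A ET.
  move=> nA AA DA [j jI].
  have [k kI] : emb (DT * A + (A * DT + A * A)) A.
    apply: emb_trans (emb_square_extend nA AA).
    have idA : emb A A by exists id.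
    by apply: emb_sum; [|apply: emb_sum]; apply: emb_prod.
  pose J a := sval (j a).
  have JI : injective J by move=> a b /sval_inj/jI.
  have JD a : ~ D W (J a) by exact: svalP (j a).
  pose pt (z : DT * A + (A * DT + A * A)) : I * I :=
    match z with
    | inl (x, a) => (sval x, J a)
    | inr (inl (a, x)) => (J a, sval x)
    | inr (inr (a, b)) => (J a, J b)
    end.
  pose V : set ((I * I) * I) :=
    W `|` [set pc | exists z, pc.2 = J (k z) /\ pc.1 = pt z].
  have DV a : D V a <-> D W a \/ exists x, a = J x.
    split.
      move=> [c [Wc|[z [_ /=]]]]; first by left; exists c.
      case: z => [[x y]|[[y x]|[x y]]] [e1 e2].
      - by left; rewrite e1; exact: svalP.
      - by left; rewrite e2; exact: svalP.
      - by right; exists x.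
    move=> [[c Wc]|[x ->]]; first by exists c; left.
    by exists (J (k (inr (inr (x, x))))); right; exists (inr (inr (x, x))).
  have newW p c z : W (p, c) -> p <> pt z.
    case: p => a b /W3[Da Db _].
    by case: z => [[x y]|[[y x]|[x y]]] [e1 e2];
      move: Da Db; rewrite e1 e2 => h1 h2; [apply: JD h2|apply: JD h1|apply: JD h1].
  apply: (maxW V).
    split; first by move=> w; left.
    have [f _] := nA.
    move=> /(_ ((J (f 0), J (f 0)), J (k (inr (inr (f 0, f 0)))))).
    move=> VW; have /W3[/JD//] := VW
      (or_intror (ex_intro _ (inr (inr (f 0, f 0))) (conj erefl erefl))).
  have pI z z' : pt z = pt z' -> z = z'.
    have nJ (x : DT) a : sval x <> J a.
      by move=> e; apply: (JD a); rewrite -e; exact: svalP.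
    have nJ' (x : DT) a : J a <> sval x by move=> /esym /nJ.
    case: z => [[x y]|[[y x]|[x y]]]; case: z' => [[x' y']|[[y' x']|[x' y']]] [] e1 e2;
      try by [case: (nJ _ _ e1)|case: (nJ _ _ e2)|case: (nJ' _ _ e1)|case: (nJ' _ _ e2)].
    - by rewrite (sval_inj e1) (JI _ _ e2).
    - by rewrite (JI _ _ e1) (sval_inj e2).
    - by rewrite (JI _ _ e1) (JI _ _ e2).
  split.
  - move=> p c c' [Wc|[z [/= -> ep]]] [Wc'|[z' [/= -> ep']]].
    + exact: W1 Wc Wc'.
    + by have := newW _ _ z' Wc; rewrite -ep'.
    + by have := newW _ _ z Wc'; rewrite -ep.
    + by rewrite (pI z z') // -ep -ep'.
  - move=> p p' c [Wc|[z [/= ec ep]]] [Wc'|[z' [/= ec' ep']]].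
    + exact: W2 Wc Wc'.
    + by case: p Wc => a b /W3[_ _]; rewrite ec' => /JD.
    + by case: p' Wc' => a b /W3[_ _]; rewrite ec => /JD.
    + by rewrite ep ep' (kI z z') //; apply: JI; rewrite -ec -ec'.
  - move=> a b c [/W3[Da Db Dc]|[z [/= -> ep]]]; first by split; apply/DV; left.
    split; apply/DV; last by right; exists (k z).
      by case: z ep => [[x y]|[[y x]|[x y]]] [-> _];
        [left; exact: svalP|right; exists y|right; exists x].
    by case: z ep => [[x y]|[[y x]|[x y]]] [_ ->];
      [right; exists y|left; exact: svalP|right; exists y].
  - move=> a b /DV[Da|[x ->]] /DV[Db|[y ->]].
    + by have [c Wc] := W4 _ _ Da Db; exists c; left.
    + by exists (J (k (inl (exist _ a Da, y)))); right; exists (inl (exist _ a Da, y)).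
    + by exists (J (k (inr (inl (x, exist _ b Db))))); right; exists (inr (inl (x, exist _ b Db))).
    + by exists (J (k (inr (inr (x, y))))); right; exists (inr (inr (x, y))).
have [nD|Dn] := emb_total nat DT.
  have [DE|ED] := emb_total DT ET.
    by exfalso; apply: (extend DT) => //; exists id.
  have IDT : emb I DT.
    apply: emb_trans IDE _; apply: emb_trans (emb_sum _ ED) _; first by exists id.
    exact: emb_trans (emb_sum_prod nD) DD.
  have DI : emb DT I by exact: emb_sub.
  exact: emb_trans (emb_prod IDT IDT) (emb_trans DD DI).
(* Here [D] is countable: either its complement contains a copy of [nat], or [I]
   itself is countable. *)
have [nE|En] := emb_total nat ET.
  by exfalso; apply: (extend nat) => //; [exists id|exact: emb_count].
have In : emb I nat.
  apply: emb_trans IDE _; apply: emb_trans (emb_sum Dn En) _.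
  exact: emb_count.
exact: emb_trans (emb_prod In In) (emb_trans (emb_count _) nI).
Qed.

Lemma emb_prod_nat I : emb nat I -> emb (I * nat) I.
Proof.
move=> nI; apply: emb_trans (emb_square nI).
by apply: emb_prod => //; exists id.
Qed.

Lemma emb_seq_infinite I : emb nat I -> emb (seq I) I.
Proof.
move=> nI; have [f fI] := emb_square nI; have [i0 _] := nI.
pose c := foldr (fun x y => f (x, y)) (i0 0).
have cI s t : size s = size t -> c s = c t -> s = t.
  elim: s t => [|x s IH] [|y t] //= [/IH cst] /fI[-> /cst ->]//.
apply: emb_trans (emb_prod_nat nI).
exists (fun s => (c s, size s)) => s t [cst sst]; exact: cI.
Qed.

Lemma cantor A : ~ emb (A -> bool) A.
Proof.
move=> [f fI]; pose h a := `[< exists g, f g = a /\ ~~ g a >].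
have := erefl (h (f h)); rewrite {1}/h; case: asboolP => [[g [/fI-> /negbTE->//]]|nh] e.
by apply: nh; exists h; rewrite -e.
Qed.

(** If the continuum does not embed in [I], neither does it embed in the set of finite
    sequences over [I * nat], even with one more integer. *)
Lemma small_seq I : ~ emb (nat -> bool) I ->
  ~ emb (nat -> bool) (nat * seq (I * nat)).
Proof.
move=> sI big; pose J := (I + nat)%type.
have nJ : emb nat J by exact: emb_inr.
have bigJ : emb (nat -> bool) J.
  apply: emb_trans big _; apply: emb_trans (emb_square nJ).
  apply: emb_prod => //; apply: emb_trans (emb_seq_infinite nJ).
  apply: emb_seq; apply: emb_trans (emb_prod_nat nJ).
  by apply: emb_prod; [exact: emb_inl|exists id].
have [nI|In] := emb_total nat I.
  apply: sI; apply: emb_trans bigJ _; apply: emb_trans (emb_square nI).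
  apply: emb_trans (emb_sum _ nI) (emb_sum_prod nI); by exists id.
apply: (@cantor nat); apply: emb_trans bigJ _.
have nn : emb nat nat by exists id.
exact: emb_trans (emb_sum In nn) (emb_count _).
Qed.

(** * Well-orderings *)

Definition strict_well_order (T : Type) (lt : T -> T -> Prop) :=
  [/\ well_founded lt, forall x y z, lt x y -> lt y z -> lt x z &
      forall x y, [\/ lt x y, x = y | lt y x]].

Lemma wf_minimal T (lt : T -> T -> Prop) (P : T -> Prop) :
  well_founded lt -> (exists x, P x) ->
  exists2 x, P x & forall y, lt y x -> ~ P y.
Proof.
move=> wf [x Px]; apply: contrapT => nomin.
elim/(well_founded_ind wf): x Px => x IH Px.
by apply: nomin; exists x => // y /IH.
Qed.

Lemma strict_well_order_exists (T : Type) : exists lt, @strict_well_order T lt.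
Proof.
have [R Rwo] := well_ordering_principle {classic T}.
pose lt (x y : T) := R x y /\ x <> y.
have RC : wo_chain R predT by move=> A _; exact: Rwo.
have Rtot : total R by move=> x y; exact: (wo_chainW RC).
have Rxx x : R x x by exact: (wo_chain_reflexive RC).
have Ranti x y : R x y -> R y x -> x = y.
  by move=> h1 h2; apply: (wo_chain_antisymmetric RC) => //; rewrite h1.
have wf : well_founded lt.
  move=> x; apply: contrapT => nx.
  have [|z [[Az minz] _]] := Rwo [pred y | `[< ~ Acc lt y >]].
    by exists x; apply/asboolP.
  move/asboolP: Az; apply; constructor => y [Ryz yz].
  apply: contrapT => ny; apply: yz; apply: Ranti => //.
  by apply: minz; apply/asboolP.
have tri x y : [\/ lt x y, x = y | lt y x].
  have [->|xy] := pselect (x = y); first by constructor 2.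
  by have /orP[h|h] := Rtot x y; [constructor 1|constructor 3; split=> // /esym].
exists lt; split => // x y z xy yz.
have asym a b : lt a b -> ~ lt b a.
  by move=> [h1 h2] [h3 _]; apply: h2; exact: Ranti.
have [//|xz|zx] := tri x z; first by subst z; case: (asym _ _ xy).
have [|w Pw minw] := @wf_minimal _ lt (fun w => [\/ w = x, w = y | w = z]) wf.
  by exists x; constructor 1.
case: Pw => ew; subst w.
- by case: (minw z zx); constructor 3.
- by case: (minw x xy); constructor 1.
- by case: (minw y yz); constructor 2.
Qed.

(** Every type has a well-ordering whose proper initial segments are all of smaller
    cardinality than the type: if some segment is as large as [T], embed [T] in the
    shortest such segment and pull the ordering back. *)
Lemma small_well_order (T : Type) : exists lt, @strict_well_order T lt /\
  forall x, ~ emb T {y | lt y x}.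
Proof.
have [lt [wf tr tri]] := strict_well_order_exists T.
have [|none] := pselect (exists x, emb T {y | lt y x}); last first.
  exists lt; split; first by split.
  by move=> x h; apply: none; exists x.
move=> /(wf_minimal wf)[p [f fI] minp].
exists (fun x y => lt (sval (f x)) (sval (f y))); split.
  split; first exact: (Inverse_Image.wf_inverse_image _ _ _ (fun x => sval (f x)) wf).
    by move=> x y z; exact: tr.
  move=> x y; have [h|h|h] := tri (sval (f x)) (sval (f y)).
  - by constructor 1.
  - by constructor 2; apply/fI/sval_inj.
  - by constructor 3.
move=> x Tx; apply: (minp (sval (f x)) (svalP (f x))).
apply: emb_trans Tx _.
exists (fun y => exist (fun z => lt z (sval (f x))) (sval (f (sval y))) (svalP y)).
by move=> y z [/sval_inj/fI/sval_inj].
Qed.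

(** * Sets of size at most the continuum *)

Lemma emb_bool_set A : emb (A -> bool) (set A) /\ emb (set A) (A -> bool).
Proof.
split; [exists (fun f a => f a : Prop) | exists (fun X a => `[< X a >])].
  move=> f g e; apply/funext => a.
  by have := congr1 (fun h : set A => h a) e; move=> /= /propeqP fg; apply/idP/idP => /fg.
move=> X Y e; apply/funext => a; apply/propext.
by have := congr1 (@^~ a) e => /= e'; split => /asboolP; rewrite (e', esym e') => /asboolP.
Qed.

Lemma emb_set A B : emb A B -> emb (set A) (set B).
Proof.
move=> [f fI]; exists (fun X => f @` X) => X Y e.
apply/seteqP; split => a Xa.
  by have : (f @` Y) (f a) by [rewrite -e; exists a]; case=> b Yb /fI <-.
by have : (f @` X) (f a) by [rewrite e; exists a]; case=> b Xb /fI <-.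
Qed.

Lemma emb_count_continuum (T : countType) : emb T continuum.
Proof.
apply: emb_trans (emb_count T) _.
by exists (fun n => [set n]) => m n /seteqP[/(_ m erefl)].
Qed.

Lemma emb_fun_continuum (T : countType) A :
  emb A continuum -> emb (T -> A) continuum.
Proof.
move=> h; apply: emb_trans (emb_fun _ h) _.
apply: (@emb_trans (set (T * nat))); last exact/emb_set/emb_count.
exists (fun g tn => g tn.1 tn.2) => g g' e.
by apply/funext => t; apply/funext => n; exact: (congr1 (@^~ (t, n)) e).
Qed.

Lemma emb_prod_continuum A B :
  emb A continuum -> emb B continuum -> emb (A * B) continuum.
Proof.
move=> hA hB; apply: emb_trans (emb_prod hA hB) _.
apply: (@emb_trans (bool -> continuum)).
  exists (fun z b => if b then z.1 else z.2) => -[a b] [a' b'] e.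
  by congr (_, _); [exact: (congr1 (@^~ true) e)|exact: (congr1 (@^~ false) e)].
by apply: emb_fun_continuum; exists id.
Qed.

Lemma emb_sum_continuum A B :
  emb A continuum -> emb B continuum -> emb (A + B) continuum.
Proof.
move=> hA hB; apply: emb_trans (emb_sum hA hB) _.
apply: emb_trans (emb_sum_prod (emb_count_continuum _)) _.
by apply: emb_prod_continuum; exists id.
Qed.

(** The weight exists because the cardinalities of the bases have a least element,
    and every base is a set of subsets. *)
Lemma weight_exists (X : topologicalType) A :
  emb (set X) A -> weight_at_most X A.
Proof.
move=> XA.
pose I := {B : set (set X) | basis B}.
have b0 : basis (@open X).
  by split => // x; move=> U; rewrite nbhsE => -[V [oV Vx] VU]; exists V.
have [[B bB] minB] := @emb_least I (fun B => set_type (sval B)) (exist _ _ b0).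
have sT (C : set (set X)) : C #= [set: set_type C].
  apply/card_eqPle; split; apply/card_le_emb.
    exact: (set_type_setT _).1.
  exact: (set_type_setT _).2.
exists (set_type B).
  split; first by exists B.
  move=> L [C bC CL]; apply/card_leqP.
  apply: emb_trans (minB (exist _ C bC)) _ => /=.
  move: CL => /card_eqPle[/card_le_emb CL _].
  exact: emb_trans CL (set_type_setT L).2.
apply/card_leqP; apply: emb_trans XA; exists val; exact: val_inj.
Qed.

(** * Finite sums in vector spaces over the two-element field *)

Lemma addb_inj (a b : bool) : a (+) b = false -> a = b.
Proof. by case: a; case: b. Qed.

(** A list over [T] stands for the sum of its entries in the vector space over the
    two-element field with basis [T], a function [e : T -> bool] for the linear form
    with these values on the basis, and [ev e s] is the value of [e] at [s]. *)
Definition ev (T : Type) (e : T -> bool) (s : seq T) : bool :=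
  \big[addb/false]_(i <- s) e i.

(** The terms of the sequence [D] are pairwise distinct vectors, that is, separated by
    linear forms.  (Different lists may represent the same vector.) *)
Definition distinct_terms (T : Type) (D : nat -> seq T) : Prop :=
  forall t t', t <> t' -> exists e, ev e (D t) <> ev e (D t').

(** The sum of two linear forms, or of two binary sequences. *)
Definition addf (T : Type) (r r' : T -> bool) : T -> bool :=
  fun t => r t (+) r' t.

Lemma addfA T : associative (@addf T).
Proof. by move=> r s t; apply/funext => x; exact: addbA. Qed.

Lemma addfC T : commutative (@addf T).
Proof. by move=> r s; apply/funext => x; exact: addbC. Qed.

Lemma addfK T (r s : T -> bool) : addf r (addf r s) = s.
Proof. by apply/funext => x; rewrite /addf addbA addbb. Qed.

Lemma ev_addf T (e e' : T -> bool) s : ev (addf e e') s = ev e s (+) ev e' s.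
Proof. exact: big_split. Qed.

Lemma ev_cat T (e : T -> bool) s s' : ev e (s ++ s') = ev e s (+) ev e s'.
Proof. exact: big_cat. Qed.

Lemma ev_cons T (e : T -> bool) i s : ev e (i :: s) = e i (+) ev e s.
Proof. exact: big_cons. Qed.

Lemma sum_pred1 (T : eqType) (e : T -> bool) (m : T) s :
  \big[addb/false]_(i <- s | i == m) e i = odd (count_mem m s) && e m.
Proof.
elim: s => [|x s IH]; first by rewrite big_nil.
rewrite big_cons IH /= oddD; case: eqP => [->|_] //=.
by case: (odd _); case: (e m).
Qed.

Lemma ev_split (T : eqType) (e : T -> bool) m s :
  ev e s = (odd (count_mem m s) && e m) (+) ev e (seq.filter (predC1 m) s).
Proof. by rewrite /ev (bigID (pred1 m)) /= sum_pred1 big_filter. Qed.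

Lemma size_filterC1 (T : eqType) (m : T) s :
  m \in s -> (size (seq.filter (predC1 m) s) < size s)%N.
Proof.
move=> ms; rewrite size_filter -(count_predC (pred1 m) s) -[X in (X < _)%N]add0n ltn_add2r.
by rewrite -has_count has_pred1.
Qed.

Lemma ev_even (T : eqType) (e : T -> bool) s :
  (forall j, ~~ odd (count_mem j s)) -> ev e s = false.
Proof.
elim: {s}(size s).+1 {-2}s (ltnSn (size s)) => // n IH [|m s]; first by rewrite /ev big_nil.
move=> sn even; rewrite (ev_split _ m) (negbTE (even m)) andFb addFb; apply: IH.
  by rewrite -ltnS (leq_trans _ sn)// ltnS size_filterC1// mem_head.
move=> j; rewrite count_filter; have [->|jm] := eqVneq j m.
  rewrite (@eq_count _ _ pred0) ?count_pred0//.
  by move=> i /=; case: eqP.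
rewrite (@eq_count _ _ (pred1 j)) // => i /=.
by case: eqP => // ->; rewrite jm.
Qed.

(** [k] is the largest basis element that occurs in the vector [s]. *)
Definition has_lead (s : seq nat) (k : nat) : Prop :=
  odd (count_mem k s) /\ forall j, (k < j)%N -> ~~ odd (count_mem j s).

Lemma ev_lead s k d : has_lead s k -> (forall j, (j < k)%N -> d j = false) ->
  ev d s = d k.
Proof.
move=> [ok ek] d0.
have -> : ev d s = ev (fun j => (j == k) && d j) s (+) ev (fun j => (k < j)%N && d j) s.
  rewrite -ev_addf; congr ev; apply/funext => j; rewrite /addf.
  by case: (ltngtP j k) => [jk|_|->] //=; rewrite ?addbF// d0.
have -> : ev (fun j => (j == k) && d j) s = d k.
  rewrite (ev_split _ k) ok eqxx /= /ev big_filter big1 ?addbF// => j /=.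
  by case: eqP.
suff -> : ev (fun j => (k < j)%N && d j) s = false by rewrite addbF.
have -> : ev (fun j => (k < j)%N && d j) s = ev d (seq.filter (fun j => k < j)%N s).
  by rewrite /ev big_filter [RHS]big_mkcond /=; apply: eq_bigr => j _; case: ifP.
apply: ev_even => j; rewrite count_filter.
have [kj|jk] := ltnP k j.
  rewrite (@eq_count _ _ (pred1 j)); first exact: ek.
  by move=> i /=; case: eqP => // ->.
rewrite (@eq_count _ _ pred0) ?count_pred0// => i /=.
by case: eqP => // ->; rewrite ltnNge jk.
Qed.

Lemma has_lead_max s k : odd (count_mem k s) -> exists2 k', (k <= k')%N & has_lead s k'.
Proof.
move=> ok; pose p j := odd (count_mem j s).
have pb j : p j -> (j <= \max_(i <- s) i)%N.
  move=> pj; apply: leq_bigmax_seq => //; rewrite -has_pred1 has_count.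
  by move: pj; rewrite /p; case: count.
have [m pm mm] := ex_maxnP (ex_intro p k ok) pb.
exists m; [exact: mm | split=> // j mj].
by apply/negP => /mm; rewrite leqNgt mj.
Qed.

Lemma nonzero_lead v : (exists e, ev e v) -> exists k, has_lead v k.
Proof.
move=> [e ve]; apply: contrapT => nk.
suff : ev e v = false by rewrite ve.
apply: ev_even => j; apply/negP => /has_lead_max[k _ vk].
by apply: nk; exists k.
Qed.

(** Only finitely many vectors have all their coordinates below [K]. *)
Lemma distinct_terms_lead (D : nat -> seq nat) K : distinct_terms D ->
  exists t k, (K <= k)%N /\ has_lead (D t) k.
Proof.
move=> dD; apply: contrapT => nD.
have even t j : (K <= j)%N -> ~~ odd (count_mem j (D t)).
  move=> Kj; apply/negP => /has_lead_max[k jk Dk]; apply: nD.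
  by exists t, k; split=> //; exact: leq_trans jk.
pose f (t : 'I_(#|{ffun 'I_K -> bool}|.+1)) := [ffun j : 'I_K => odd (count_mem (val j) (D t))].
suff /leq_card : injective f by rewrite card_ord ltnn.
move=> t t' /ffunP ftt'; apply/val_inj; apply: contrapT => /dD[e]; apply.
apply: addb_inj; rewrite -ev_cat; apply: ev_even => j; rewrite count_cat oddD.
have [Kj|jK] := leqP K j; first by rewrite (negbTE (even _ _ Kj)) (negbTE (even _ _ Kj)).
by have := ftt' (Ordinal jK); rewrite !ffunE => /= ->; rewrite addbb.
Qed.

(** A system of equations in echelon form has a solution: the value at the leading
    index [k m] is adjusted last among those on which the [m]-th equation depends. *)
Lemma solve_leads (Y : nat -> seq nat) (k : nat -> nat) (tau : nat -> bool) :
  (forall m, has_lead (Y m) (k m)) -> (forall m, k m < k m.+1)%N ->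
  exists e, forall m, ev e (Y m) = tau m.
Proof.
move=> kY kS.
have kM m m' : (m < m')%N -> (k m < k m')%N.
  elim: m' => // m' IH; rewrite ltnS leq_eqVlt => /orP[/eqP->//|/IH h].
  exact: ltn_trans h (kS m').
have km m : (m <= k m)%N.
  by elim: m => // m IH; exact: leq_ltn_trans IH (kS m).
pose step m (e : nat -> bool) j := e j (+) ((j == k m) && (ev e (Y m) (+) tau m)).
pose E := fix E m := if m is m'.+1 then step m' (E m') else fun _ => false.
have Estab m m' j : (m <= m')%N -> (j < k m)%N -> E m' j = E m j.
  move=> mm' jm; elim: m' mm' => [|m' IH]; first by rewrite leqn0 => /eqP->.
  rewrite leq_eqVlt => /orP[/eqP->//|]; rewrite ltnS => mm' /=.
  rewrite /step; suff /negbTE-> : j != k m' by rewrite addbF IH.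
  rewrite neq_ltn (leq_trans jm) //.
  by move: mm'; rewrite leq_eqVlt => /orP[/eqP->//|/kM/ltnW].
pose e j := E j.+1 j.
have eE m j : (j < k m)%N -> e j = E m j.
  move=> jm; rewrite /e.
  rewrite -(Estab j.+1 (maxn m j.+1) j (leq_maxr _ _) (km _)).
  exact: (Estab _ _ _ (leq_maxl _ _) jm).
exists e => m.
have : ev (addf e (E m.+1)) (Y m) = false.
  rewrite (ev_lead (kY m)) => [|j jm]; rewrite /addf (eE m.+1) ?addbb//.
  exact: ltn_trans jm (kS m).
rewrite ev_addf => /addb_inj ->.
have -> : E m.+1 = addf (E m) (fun j => (j == k m) && (ev (E m) (Y m) (+) tau m)) by [].
rewrite ev_addf [X in _ (+) X](ev_lead (kY m)) ?eqxx /=.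
  by rewrite addbA addbb.
by move=> j jm; rewrite ltn_eqF.
Qed.

(** For countably many sequences [sigma n] of distinct vectors and one nonzero vector
    [v], there is a family of forms [E j], indexed by binary sequences, which take the
    value 1 at [v] and such that [j] can be read off from the values of [E j] along any
    single [sigma n]. *)
Lemma candidates (sigma : nat -> nat -> seq nat) (v : seq nat) :
  (exists e, ev e v) ->
  exists (E : (nat -> bool) -> nat -> bool) (T : nat -> nat -> nat),
    forall j, ev (E j) v /\
      forall n k, distinct_terms (sigma n) -> ev (E j) (sigma n (T n k)) = j k.
Proof.
move=> /nonzero_lead[k0 vk0].
pose dec m : nat * nat := odflt (0, 0)%N (unpickle m).
have exP (p : nat * nat) : exists q : seq nat * nat * nat,
    [/\ (p.2 < q.1.2)%N, has_lead q.1.1 q.1.2 &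
        distinct_terms (sigma (dec p.1).1) -> q.1.1 = sigma (dec p.1).1 q.2].
  case: p => m K /=.
  have [d|nd] := pselect (distinct_terms (sigma (dec m).1)).
    by have [t [k [Kk tk]]] := distinct_terms_lead K.+1 d; exists (sigma (dec m).1 t, k, t).
  exists ([:: K.+1], K.+1, 0%N) => /=; split=> //; split=> /=; first by rewrite eqxx.
  by move=> j Kj; rewrite ltn_eqF.
have [step stepP] := choice exP.
(* Terms [sigma n (T n k)], one for each pair [(n, k)], are picked so that the leading
   indices increase, starting from that of [v]. *)
pose S := fix S m := if m is m'.+1 then step (m', (S m').1.2) else (v, k0, 0%N).
have lead m : has_lead (S m).1.1 (S m).1.2.
  by case: m => // m; have [] := stepP (m, (S m).1.2).
have incr m : ((S m).1.2 < (S m.+1).1.2)%N by have [] := stepP (m, (S m).1.2).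
have [E EP] := choice (fun j : nat -> bool => solve_leads
  (fun m => if m is m'.+1 then j (dec m').2 else true) lead incr).
exists E, (fun n k => (S (pickle (n, k)).+1).2) => j; split; first exact: (EP j 0%N).
move=> n k dn; have := EP j (pickle (n, k)).+1.
have [_ _] := stepP (pickle (n, k), (S (pickle (n, k))).1.2).
by rewrite /= /dec pickleK /= => /(_ dn) ->.
Qed.

(** * Generic families of linear forms *)

(** Transfinite recursion with choices. *)
Lemma wf_choice (P A : Type) (lt : P -> P -> Prop)
    (Good : forall i, ({j | lt j i} -> A) -> A -> Prop) :
  well_founded lt -> (forall i r, exists a, Good i r a) ->
  exists e : P -> A, forall i, Good i (fun j => e (sval j)) (e i).
Proof.
move=> wf ex.
pose g i r : A := sval (cid (ex i r)).
pose F i (rec : forall j, lt j i -> A) : A := g i (fun j => rec (sval j) (svalP j)).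
pose e := Fix wf (fun _ => A) F.
have eE i : e i = g i (fun j => e (sval j)).
  rewrite /e Fix_eq // => x r r' rr'; congr (F x _).
  by apply: functional_extensionality_dep => j; apply/funext => h; exact: rr'.
by exists e => i; rewrite eE; exact: (svalP (cid (ex _ _))).
Qed.

(** Given at most [c] configurations, forms [e i] can be chosen along a well-ordering
    so that [e i] is 1 at [v i] whenever [v i] is nonzero, and the values of [e i]
    along any of its sequences of distinct vectors are not a linear combination of
    the value sequences of the earlier forms. *)
Lemma generic_family (P : Type) (sigma : P -> nat -> nat -> seq nat)
    (v : P -> seq nat) : emb P (nat -> bool) ->
  exists lt, @strict_well_order P lt /\ exists e : P -> nat -> bool, forall i,
    ((exists e', ev e' (v i)) -> ev (e i) (v i)) /\
    forall n, distinct_terms (sigma i n) -> forall l : seq ({j | lt j i} * nat),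
      (fun t => ev (e i) (sigma i n t)) <>
      (fun t => ev (fun q => ev (e (sval q.1)) (sigma (sval q.1) q.2 t)) l).
Proof.
move=> Pc; have [lt [wo small]] := small_well_order P.
exists lt; split=> //; case: wo => wf _ _.
apply: (wf_choice (Good := fun i r a => ((exists e', ev e' (v i)) -> ev a (v i)) /\
    forall n, distinct_terms (sigma i n) -> forall l : seq ({j | lt j i} * nat),
      (fun t => ev a (sigma i n t)) <>
      (fun t => ev (fun q => ev (r q.1) (sigma (sval q.1) q.2 t)) l)) wf).
move=> i r.
pose w := if `[< exists e, ev e (v i) >] then v i else [:: 0%N].
have /candidates : exists e, ev e w.
  by rewrite /w; case: asboolP => // _; exists xpredT; rewrite /ev big_seq1.
move=> /(_ (sigma i))[E [T ET]].
apply: contrapT => none.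
(* Otherwise each of the [c] candidates [E j] is excluded by a pair [nl], from which
   [j] can be recovered. *)
have bad j : exists nl : nat * seq ({j | lt j i} * nat), distinct_terms (sigma i nl.1) /\
      (fun t => ev (E j) (sigma i nl.1 t)) =
      (fun t => ev (fun q => ev (r q.1) (sigma (sval q.1) q.2 t)) nl.2).
  apply: contrapT => nbad; apply: none; exists (E j); split.
    move=> vi; have [+ _] := ET j; rewrite /w; case: asboolP => //.
  by move=> n dn l e; apply: nbad; exists (n, l).
have [h hP] := choice bad.
apply: (small_seq (I := {j | lt j i})).
  by move=> big; apply: (small i); exact: emb_trans Pc big.
exists h => j j' hj; apply/funext => k.
have [d1 e1] := hP j; have [_] := hP j'; rewrite -hj -e1 => e2.
rewrite -((ET j).2 (h j).1 k d1) -((ET j').2 (h j).1 k d1).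
exact: (congr1 (@^~ (T (h j).1 k)) (esym e2)).
Qed.

(** Additivity, that is linearity over the two-element field. *)
Definition xor_additive (T : Type) (lam : (T -> bool) -> bool) : Prop :=
  forall r r', lam (addf r r') = lam r (+) lam r'.

(** A linear form with prescribed values [tau i] at the vectors [u i] exists as soon as
    the prescription respects all linear relations.  It is the indicator function of the
    complement of a subgroup that is maximal among those containing the combinations of the
    [u i] with prescribed value 0 and missing a vector [u i0] with prescribed value 1:
    such a subgroup has index 2. *)
Lemma linear_extension (I T : Type) (u : I -> T -> bool) (tau : I -> bool) :
  (forall s : seq I, (fun t => ev (u^~ t) s) = (fun _ => false) -> ev tau s = false) ->
  exists lam, xor_additive lam /\ forall i, lam (u i) = tau i.
Proof.
move=> ind.
have [[i0 ti0]|none] := pselect (exists i, tau i); last first.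
  exists (fun _ => false); split=> // i.
  by apply/esym/negbTE/negP => ti; apply: none; exists i.
pose K0 : set (T -> bool) := [set r | exists2 s, r = (fun t => ev (u^~ t) s) & ev tau s = false].
have K00 : K0 (fun _ => false).
  by exists [::]; [apply/funext => t|]; rewrite /ev big_nil.
have K0D r r' : K0 r -> K0 r' -> K0 (addf r r').
  move=> [s -> s0] [s' -> s'0]; exists (s ++ s'); last by rewrite ev_cat s0 s'0.
  by apply/funext => t; rewrite ev_cat.
have K0u : ~ K0 (u i0).
  move=> [s e s0]; suff : ev tau (i0 :: s) = false by rewrite ev_cons ti0 s0.
  by apply: ind; apply/funext => t; rewrite ev_cons e addbb.
pose good (K : set (T -> bool)) :=
  (forall r r', K r -> K r' -> K (addf r r')) /\ ~ K (u i0).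
have [|K [[KD Ku] maxK]] := @Zorn_bigcup _ (fun K => good (K `|` K0)).
  move=> F PF totF; split; last by move=> [[X FX Xu]|//]; case: (PF _ FX) => _; apply; left.
  have lift X r : F X -> (X `|` K0) r -> (\bigcup_(X in F) X `|` K0) r.
    by move=> FX [Xr|]; [left; exists X|right].
  move=> r r' [[X FX Xr]|K0r] [[Y FY Yr]|K0r'].
  - have [XY|YX] := totF _ _ FX FY.
      by apply: (lift _ _ FY); apply: (PF _ FY).1; left => //; exact: XY.
    by apply: (lift _ _ FX); apply: (PF _ FX).1; left => //; exact: YX.
  - by apply: (lift _ _ FX); apply: (PF _ FX).1; [left|right].
  - by apply: (lift _ _ FY); apply: (PF _ FY).1; [right|left].
  - by right; exact: K0D.
set K' := K `|` K0 in KD Ku.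
have K'0 : K' (fun _ => false) by right.
have step r : ~ K' r -> K' (addf r (u i0)).
  move=> nr; apply: contrapT => nru.
  pose K2 : set (T -> bool) := K' `|` [set s | K' (addf r s)].
  have K2E : K2 `|` K0 = K2 by apply/setUidPl => x K0x; left; right.
  apply: (maxK K2).
    split; first by move=> x Kx; left; left.
    move=> /(_ r); suff K2r : K2 r by move=> /(_ K2r) Kr; apply: nr; left.
    by right; rewrite /= (_ : addf r r = fun _ => false) //; apply/funext => t; exact: addbb.
  rewrite K2E; split; last by case.
  move=> x y [K'x|/= K'x] [K'y|/= K'y].
  - by left; exact: KD.
  - by right; rewrite /= addfA (addfC r) -addfA; exact: KD.
  - by right; rewrite /= addfA; exact: KD.
  - left; have -> : addf x y = addf (addf r x) (addf r y).
      by rewrite (addfC r) -addfA addfK.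
    exact: KD.
pose lam r := `[< ~ K' r >].
have lam0 r : K' r -> lam r = false by move=> Kr; apply/asboolP => /(_ Kr).
have lam1 r : ~ K' r -> lam r = true by move=> Kr; apply/asboolP.
exists lam; split.
  move=> r r'; have [Kr|Kr] := pselect (K' r); have [Kr'|Kr'] := pselect (K' r').
  - by rewrite (lam0 r) // (lam0 r') // lam0 //; exact: KD.
  - rewrite (lam0 r) // (lam1 r') // lam1 // => Krr'; apply: Kr'.
    by rewrite -(addfK r r'); exact: KD.
  - rewrite (lam1 r) // (lam0 r') // lam1 // => Krr'; apply: Kr.
    by rewrite -(addfK r' r); apply: KD => //; rewrite addfC.
  - rewrite (lam1 r) // (lam1 r') // lam0 //.
    have -> : addf r r' = addf (addf r (u i0)) (addf r' (u i0)).
      by rewrite (addfC r') -addfA addfK.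
    by apply: KD; exact: step.
move=> i; case ti : (tau i); last first.
  by apply: lam0; right; exists [:: i]; [apply/funext => t|]; rewrite /ev big_seq1.
apply: lam1 => Ki; apply: Ku; rewrite -(addfK (u i) (u i0)); apply: KD => //.
right; exists [:: i; i0]; last by rewrite /ev big_cons big_seq1 ti ti0.
by apply/funext => t; rewrite /ev big_cons big_seq1.
Qed.

(** A family in which no vector is a combination of earlier ones is linearly
    independent, so any prescription of values respects its relations. *)
Lemma wo_independent (I : eqType) (T : Type) (lt : I -> I -> Prop)
    (u : I -> T -> bool) (tau : I -> bool) :
  strict_well_order lt ->
  (forall i (l : seq I), (forall j, j \in l -> lt j i) ->
    u i <> (fun t => ev (u^~ t) l)) ->
  forall s : seq I, (fun t => ev (u^~ t) s) = (fun _ => false) -> ev tau s = false.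
Proof.
move=> [_ tr tri] indep s; elim: {s}(size s).+1 {-2}s (ltnSn (size s)) => // n IH s sn s0.
have [->|sN] := eqVneq s [::]; first by rewrite /ev big_nil.
have [m ms maxm] : exists2 m, m \in s & forall j, j \in s -> j = m \/ lt j m.
  elim: s {sn s0} sN => // x s IHs _.
  have [->|/IHs[m ms maxm]] := eqVneq s [::].
    by exists x => [|j]; rewrite inE ?eqxx// => /eqP; left.
  have [xm|xm|mx] := tri x m.
  - exists m => [|j]; rewrite inE ?ms ?orbT// => /orP[/eqP->|/maxm//]; by right.
  - exists m => [|j]; rewrite inE ?ms ?orbT// => /orP[/eqP->|/maxm//]; by left.
  - exists x => [|j]; rewrite inE ?eqxx// => /orP[/eqP->|/maxm[->|jm]]; [by left|by right|].
    right; exact: tr jm mx.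
pose s' := seq.filter (predC1 m) s.
have s'm j : j \in s' -> lt j m.
  by rewrite mem_filter => /andP[/= /eqP jm /maxm[]].
case om : (odd (count_mem m s)); last first.
  rewrite (ev_split _ m) om andFb addFb; apply: IH.
    by rewrite -ltnS (leq_trans _ sn)// ltnS size_filterC1.
  rewrite -s0; apply/funext => t; by rewrite [RHS](ev_split _ m) om andFb addFb.
case: (indep m s' s'm); apply/funext => t; apply: addb_inj.
by have := congr1 (@^~ t) s0; rewrite /= (ev_split _ m) om.
Qed.

(** There are linear forms [lam x] on binary sequences, for [x] a subset of a set [C] of
    size at most [c], such that every countable system of conditions
    [lam (x n) (e o sigma n) = e n] with distinct labels [x n] has a solution [e] that
    is 1 at a given nonzero vector [v]. *)
Lemma generic_functionals (C : Type) : emb C continuum ->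
  exists lam : set C -> (nat -> bool) -> bool, (forall x, xor_additive (lam x)) /\
  forall (x : nat -> set C) (sigma : nat -> nat -> seq nat) (v : seq nat),
    injective x -> (exists e, ev e v) ->
    exists e, ev e v /\
      forall n, distinct_terms (sigma n) -> lam (x n) (fun t => ev e (sigma n t)) = e n.
Proof.
move=> Cc.
(* A completed configuration consists of the sequences [sigma], the vector [v], test
   points [c (k, l)] of [C], and the expected answers [a n (k, l)] of the [n]-th label
   to the tests. *)
pose P0 := ((nat -> nat -> seq nat) * seq nat * (nat * nat -> C) *
            (nat -> nat * nat -> bool))%type.
pose P : eqType := {classic P0}.
have Pc : emb P (nat -> bool).
  apply: emb_trans (emb_bool_set nat).2.
  have bc : emb bool continuum by exact: emb_count_continuum.
  have sc : emb (seq nat) continuum by exact: emb_count_continuum.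
  apply: (@emb_prod_continuum ((nat -> nat -> seq nat) * seq nat * (nat * nat -> C))%type).
    apply: emb_prod_continuum; last exact: emb_fun_continuum.
    by apply: emb_prod_continuum => //; do 2 apply: emb_fun_continuum.
  by do 2 apply: emb_fun_continuum.
pose sg (i : P) : nat -> nat -> seq nat := (i : P0).1.1.1.
pose vv (i : P) : seq nat := (i : P0).1.1.2.
pose c (i : P) : nat * nat -> C := (i : P0).1.2.
pose a (i : P) : nat -> nat * nat -> bool := (i : P0).2.
have [lt [wo [e eP]]] := generic_family sg vv Pc.
(* The label [x] occupies position [n] in [i], and the [n]-th sequence of [i] imposes a
   condition. *)
pose act (x : set C) (i : P) n :=
  (forall kl, `[< x (c i kl) >] = a i n kl) /\ distinct_terms (sg i n).
pose I x := {i : P | `[< exists n, act x i n >]}.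
pose idx x (i : I x) : nat := sval (cid (asboolW (svalP i))).
have idxP x (i : I x) : act x (sval i) (idx x i) by exact: svalP (cid _).
pose u x (i : I x) t := ev (e (sval i)) (sg (sval i) (idx x i) t).
pose tau x (i : I x) := e (sval i) (idx x i).
have ex x : exists lam, xor_additive lam /\ forall i : I x, lam (u x i) = tau x i.
  apply: linear_extension; apply: (wo_independent (lt := fun i j : I x => lt (sval i) (sval j))).
    case: wo => wf tr tri; split.
    - exact: (wf_inverse_image _ _ _ (fun i : I x => sval i) wf).
    - by move=> i j k; exact: tr.
    - move=> i j; have [h|h|h] := tri (sval i) (sval j); [by constructor 1| |by constructor 3].
      by constructor 2; exact: val_inj.
  move=> i l li ui.
  have [_ di] := idxP x i.
  have [_ /(_ _ di)] := eP (sval i).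
  pose h (j : I x) : option ({j | lt j (sval i)} * nat) :=
    if pselect (lt (sval j) (sval i)) is left h then Some (exist _ (sval j) h, idx x j) else None.
  move=> /(_ (pmap h l)); apply; rewrite -[LHS]/(u x i) ui.
  apply/funext => t.
  elim: l li {ui} => [|j l IH] li; first by rewrite /ev !big_nil.
  rewrite /= ev_cons IH => [|k kl]; last by apply: li; rewrite inE kl orbT.
  have := li j (mem_head _ _); rewrite /h; case: pselect => // lji _ /=.
  by rewrite ev_cons.
have [lam lamP] := choice ex.
exists lam; split=> [x|]; first by case: (lamP x).
move=> x sigma v xI vN.
have sep kl : exists z, kl.1 <> kl.2 -> ~ (x kl.1 z <-> x kl.2 z).
  have [klE|klN] := pselect (kl.1 = kl.2).
    have [z|noC] := pselect (exists z : C, True); first by exists (sval (cid z)).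
    exfalso; suff : 0%N = 1%N by [].
    by apply: xI; apply/seteqP; split=> z; case: noC; exists z.
  apply: contrapT => nz; apply: klN; apply: xI; apply/seteqP.
  by split=> z xz; apply: contrapT => nxz; apply: nz; exists z => _ [h1 h2]; apply: nxz; auto.
have [cc ccP] := choice sep.
pose i : P := (sigma, v, cc, fun n kl => `[< x n (cc kl) >]).
exists (e i); split; first by apply: (eP i).1.
move=> n dn.
have ai : act (x n) i n by split.
have Ii : `[< exists n', act (x n) i n' >] by apply/asboolP; exists n.
pose j : I (x n) := exist _ i Ii.
(* The test at [(idx j, n)] distinguishes the label [x n] from any other label. *)
have jn : idx _ j = n.
  have [h _] := idxP _ j; apply: contrapT => jn.
  have := ccP (idx _ j, n) jn; apply.
  have := h (idx _ j, n); rewrite /a /= => /esym e1.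
  by split=> hx; apply/asboolP; [rewrite -e1|rewrite e1]; apply/asboolP.
have := (lamP (x n)).2 j; rewrite /tau /u jn /=.
by move=> <-.
Qed.

(** * Infinite quotients of small size *)

Section SmallQuotient.
Variable G : topologicalZmodType.
Local Open Scope ring_scope.

Lemma zmodClosed_of (P : G -> Prop) : P 0 -> (forall a b, P a -> P b -> P (a - b)) ->
  exists N : zmodClosed G, forall a, (a \in N) = `[< P a >].
Proof.
move=> P0 PB; pose p : {pred G} := fun a => `[< P a >].
have pc : zmod_closed p.
  split; first exact/asboolP.
  by move=> a b /asboolP Pa /asboolP Pb; apply/asboolP; exact: PB.
by exists (HB.pack_for (zmodClosed G) p (GRing.isZmodClosed.Build G p pc)).
Qed.

Lemma quot_eqP (N : zmodClosed G) (a b : G) :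
  \pi_(quotient_group N)%qT a = \pi_(quotient_group N)%qT b <-> a - b \in N.
Proof. rewrite Quotient.idealrBE; split=> [e|/eqP e]; [apply/eqP|]; exact: e. Qed.

Lemma repr_pi (N : zmodClosed G) (a : G) :
  repr (\pi_(quotient_group N)%qT a) - a \in N.
Proof. by apply/quot_eqP; rewrite reprK. Qed.

Lemma nbhs_sub (U : set G) : nbhs 0 U ->
  exists2 V, nbhs 0 V & forall a b, V a -> V b -> U (a - b).
Proof.
move=> U0; have := @sub_continuous G (0, 0) U.
rewrite /= subr0 => /(_ U0)[[V W] /= [V0 W0] VW].
exists (V `&` W); first exact: filterI.
by move=> a b [Va _] [_ Wb]; exact: (VW (a, b)).
Qed.

Lemma nbhs_neq (a : G) : hausdorff_space G -> a <> 0 -> nbhs 0 (~` [set a]).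
Proof.
move=> /hausdorff_accessible/accessible_closed_set1/(_ a) ca a0.
by apply: open_nbhs_nbhs; split; [rewrite openC|move=> /= /esym].
Qed.

(** Every infinite precompact Hausdorff group has an infinite quotient of size at most [c]. *)
Lemma infinite_small_quotient :
  hausdorff_space G -> infinite_set [set: G] -> precompact_group G ->
  exists N : zmodClosed G,
    [/\ closed [set x : G | x \in N], infinite_set [set: quotient_group N] &
        emb (quotient_group N) continuum].
Proof.
move=> HG Ginf Gpre.
have [x xI] : emb nat G.
  by apply/card_leqP; apply/infiniteP.
(* The pairs of integers are enumerated by [dec]; at stage [m] the difference of the
   corresponding two points of the sequence [x] is kept out of the neighbourhood. *)
pose dec m : nat * nat := odflt (0, 0)%N (unpickle m).
have stepP (mU : nat * set G) : exists V, nbhs 0 mU.2 ->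
    [/\ nbhs 0 V, forall a b, V a -> V b -> mU.2 (a - b) &
        (dec mU.1).1 <> (dec mU.1).2 -> ~ V (x (dec mU.1).1 - x (dec mU.1).2)].
  case: mU => m U /=; have [U0|nU] := pselect (nbhs 0 U); last by exists U.
  have [V V0 VU] := nbhs_sub U0.
  have [e|ne] := pselect ((dec m).1 = (dec m).2); first by exists V.
  exists (V `&` ~` [set (x (dec m).1 - x (dec m).2)]) => _; split.
  - apply: filterI => //; apply: nbhs_neq => // /eqP; rewrite subr_eq0 => /eqP/xI.
    exact: ne.
  - by move=> a b [Va _] [Vb _]; exact: VU.
  - by move=> _ [_ /=]; apply.
have [step {}stepP] := choice stepP.
pose U := fix U m := if m is m'.+1 then step (m', U m') else setT.
have U0 m : nbhs 0 (U m).
  elim: m => [|m IH]; first exact: filterT.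
  by have [] := stepP (m, U m) IH.
have UB m a b : U m.+1 a -> U m.+1 b -> U m (a - b).
  by have [_ + _] := stepP (m, U m) (U0 m); apply.
have Ux k l : k <> l -> exists m, ~ U m (x k - x l).
  move=> kl; exists (pickle (k, l)).+1.
  have [_ _] := stepP (pickle (k, l), U (pickle (k, l))) (U0 _).
  by rewrite /= /dec pickleK /=; apply.
have [|a b Na Nb m|N NE] := @zmodClosed_of (fun a => forall m, U m a).
- by move=> m; exact: nbhs_singleton.
- exact: UB.
have NP a : a \in N <-> forall m, U m a by rewrite NE; split=> /asboolP.
exists N; split.
- rewrite -openC openE => a /= /NP; rewrite -existsNE => -[m Um].
  have : nbhs a ((fun b => b - a) @^-1` U m.+1).
    have := @sub_continuous G (a, a) (U m.+1); rewrite /= subrr => /(_ (U0 m.+1)).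
    move=> [[V W] /= [Va Wa] VW]; apply: filterS Va => b Vb /=.
    by apply: (VW (b, a)); split => //; exact: nbhs_singleton.
  apply: filterS => b /= Uba /NP/(_ m.+1) Ub; apply: Um.
  have -> : a = b - (b - a) by rewrite opprB addrC subrK.
  exact: UB.
- apply/infiniteP/card_leqP; exists (fun n => \pi_(quotient_group N)%qT (x n)).
  move=> k l /quot_eqP/NP kl; apply: contrapT => /Ux[m]; apply; exact: kl.
(* Rounding to a finite net modulo [U m.+1] determines points up to [U m]. *)
have Fex m : exists g : G -> nat, forall a b, g a = g b -> U m (a - b).
  have [F Ffin FE] := Gpre _ (U0 m.+1).
  have /countable_injP[h hI] := finite_set_countable Ffin.
  have net (a : G) : exists f, F f /\ U m.+1 (a - f).
    have : [set: G] a by []; rewrite FE => -[f Ff [u Uu <-]].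
    by exists f; split=> //; rewrite addrC addKr.
  have [r rP] := choice net.
  exists (h \o r) => a b /= /hI; rewrite !inE => /(_ (rP a).1 (rP b).1) rab.
  have -> : a - b = (a - r a) - (b - r b) by rewrite rab opprB addrA subrK.
  by apply: UB; [exact: (rP a).2|exact: (rP b).2].
have [g gP] := choice Fex.
apply: (@emb_trans (nat -> nat)); last first.
  exact/emb_fun_continuum/emb_count_continuum.
exists (fun q m => g m (repr q)) => p q e.
rewrite -[p]reprK -[q]reprK; apply/quot_eqP/NP => m.
by apply: gP; exact: (congr1 (@^~ m) e).
Qed.

End SmallQuotient.

Lemma no_inj_nat_fin (T : finType) (f : nat -> T) : ~ injective f.
Proof.
move=> fI; have /leq_card : injective (fun i : 'I_(#|T|.+1) => f (val i)).
  by move=> i j /fI/val_inj.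
by rewrite card_ord ltnn.
Qed.

(** * Indices and admissible functions *)

(** The basis of the space [H].  The index [limit x K d] is the limit number [x] of
    the sequence of vectors [points K d], whose [t]-th term is the sum of the [K t]
    indices [d t 0], [d t 1] and so on. *)
Inductive index : Type :=
| base : nat -> index
| limit : set continuum -> (nat -> nat) -> (nat -> nat -> index) -> index.

Definition points (K : nat -> nat) (d : nat -> nat -> index) (t : nat) : seq index :=
  [seq d t k | k <- iota 0 (K t)].

(** Indices are coded by sets of pairs: a position in the tree together with a piece
    of information on the node found there. *)
Definition labels : Type := (seq (nat * nat) * (continuum + nat * nat + nat))%type.

(** [code b p z]: the node of [b] at position [p] carries the information [z], which is the
    number of a base index, a member of the label [x] of a limit index, or a pair [(t, K t)]. *)
Fixpoint code (b : index) (p : seq (nat * nat)) (z : continuum + nat * nat + nat) : Prop :=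
  match b, p with
  | base n, [::] => z = inr n
  | base n, _ :: _ => False
  | limit x K d, [::] =>
      match z with
      | inl (inl c) => x c
      | inl (inr tk) => K tk.1 = tk.2
      | inr _ => False
      end
  | limit x K d, tk :: q => code (d tk.1 tk.2) q z
  end.

Definition codes (b : index) : set labels := fun pz => code b pz.1 pz.2.

Lemma codes_inj : injective codes.
Proof.
move=> b b' e.
have {e} : forall p z, code b p z = code b' p z.
  by move=> p z; exact: (congr1 (fun X : set labels => X (p, z)) e).
elim: b b' => [n|x K d IH] [n'|x' K' d'] e.
- by have := e [::] (inr n) => /= h; have : inr n = inr n' :> continuum + nat * nat + nat;
    [rewrite -h|case=> ->].
- by have := e [::] (inr n) => /= h; exfalso; rewrite -h.
- by have := e [::] (inr n') => /= h; exfalso; rewrite h.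
have -> : x = x' by apply/funext => c; exact: (e [::] (inl (inl c))).
have -> : K = K'.
  by apply/funext => t; have /= := e [::] (inl (inr (t, K t))) => h; apply/esym; rewrite -h.
congr limit; apply/funext => t; apply/funext => k.
by apply: IH => p z; exact: (e ((t, k) :: p) z).
Qed.

Lemma labels_continuum : emb labels continuum.
Proof.
apply: emb_prod_continuum; first exact: emb_count_continuum.
apply: emb_sum_continuum; last exact: emb_count_continuum.
by apply: emb_sum_continuum; [exists id|exact: emb_count_continuum].
Qed.

(** The linear form [lam_b] used at an index [b] with [codes b = x]. *)
Definition functional : set labels -> (nat -> bool) -> bool :=
  sval (cid (generic_functionals labels_continuum)).

Lemma functional_additive x : xor_additive (functional x).
Proof. exact: (svalP (cid (generic_functionals labels_continuum))).1. Qed.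

Lemma functional_generic (x : nat -> set labels) (sigma : nat -> nat -> seq nat) (v : seq nat) :
  injective x -> (exists e, ev e v) ->
  exists e, ev e v /\
    forall n, distinct_terms (sigma n) -> functional (x n) (fun t => ev e (sigma n t)) = e n.
Proof. exact: (svalP (cid (generic_functionals labels_continuum))).2. Qed.

Lemma functional0 x : functional x (fun _ => false) = false.
Proof.
have := functional_additive x (fun _ => false) (fun _ => false).
by rewrite [addf _ _](_ : _ = fun _ => false) ?addbb//.
Qed.

(** The elements of the group: functions on the indices whose value at a limit of a
    sequence of distinct vectors is computed from the values along the sequence. *)
Definition admissible (g : index -> bool) : Prop :=
  forall x K d, distinct_terms (points K d) ->
    functional (codes (limit x K d)) (fun t => ev g (points K d t)) = g (limit x K d).

(** The subtree of [b] at position [p]; positions that leave the tree are cut short. *)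
Fixpoint subtree (b : index) (p : seq (nat * nat)) {struct p} : index :=
  match p, b with
  | tk :: q, limit x K d => subtree (d tk.1 tk.2) q
  | _, _ => b
  end.

(** Admissible functions separate the points of [H]. *)
Lemma admissible_separates (v : seq index) : (exists e, ev e v) ->
  exists2 g, admissible g & ev g v.
Proof.
move=> [e0 e0v].
(* A countable set of indices, closed under subtrees, that contains the entries of
   [v]; the base indices make it infinite. *)
pose S : set index := [set b | (exists n, b = base n) \/
  exists i p, [/\ (i < size v)%N & b = subtree (nth (base 0) v i) p]].
have [s [sI sS]] : exists s : nat -> index, injective s /\ forall b, S b <-> exists n, b = s n.
  have Scount : countable S.
    pose f (z : nat + nat * seq (nat * nat)) := match z with
      | inl n => base n | inr ip => subtree (nth (base 0) v ip.1) ip.2 end.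
    apply: (@sub_countable _ _ _ (range f)).
      apply: subset_card_le => b [[n ->]|[i [p [_ ->]]]]; first by exists (inl n).
      by exists (inr (i, p)).
    exact: (card_le_trans (card_image_le _ _) (countableP _)).
  have Sinf : infinite_set S.
    apply/infiniteP/card_le_emb; apply: emb_trans (set_type_setT nat).2 _.
    exists (fun n => SigSub (mem_set (or_introl (ex_intro _ n erefl) : S (base n)))).
    by move=> m n [].
  have := eq_card_nat Scount Sinf; rewrite card_eq_sym => /card_bijP[f [g fg gf]].
  pose emb_nat n : [set: nat] := SigSub (mem_set (I : [set: nat] n)).
  exists (fun n => val (f (emb_nat n))); split.
    by move=> m n /val_inj/(can_inj fg)[].
  move=> b; split=> [Sb|[n ->]]; last by apply: set_mem; exact: valP.
  exists (val (g (SigSub (mem_set Sb)))).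
  rewrite (_ : emb_nat _ = g (SigSub (mem_set Sb))) ?gf//.
  exact/val_inj.
have Sv i : (i < size v)%N -> S (nth (base 0) v i).
  by move=> iv; right; exists i, [::]; split.
have Schild x K d t k : S (limit x K d) -> S (d t k).
  move=> [[n]//|[i [p [iv ei]]]]; right; exists i, (rcons p (t, k)); split=> //.
  elim: p (nth _ _ _) ei => [|tk p IH] b /=; first by move=> <-.
  by case: b => [n//|x' K' d'] /=; exact: IH.
pose ix b : nat := if pselect (exists n, b = s n) is left h then sval (cid h) else 0%N.
have ixK b : S b -> s (ix b) = b.
  by move=> /sS Sb; rewrite /ix; case: pselect => // h; case: cid.
have sK n : ix (s n) = n by apply: sI; apply: ixK; apply/sS; exists n.
have ev_ix (e : nat -> bool) g l : (forall b, S b -> g b = e (ix b)) ->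
    (forall i, (i < size l)%N -> S (nth (base 0) l i)) -> ev g l = ev e (map ix l).
  move=> ge; elim: l => [|b l IH] lS; first by rewrite /ev !big_nil.
  rewrite /= !ev_cons (ge b) ?IH//; last exact: (lS 0%N).
  by move=> i il; exact: (lS i.+1).
pose sigma n t : seq nat := if s n is limit x K d then map ix (points K d t) else [::].
have [m n /codes_inj/sI//||e [ev_v eP]] := @functional_generic (codes \o s) sigma (map ix v).
  exists (e0 \o s); rewrite -(ev_ix _ e0) //= => b Sb.
  by rewrite /= ixK.
(* Outside [S] the values are forced, or 0 when no condition applies. *)
pose g := fix g b := if `[< S b >] then e (ix b) else
  match b with
  | base _ => false
  | limit x K d => if `[< distinct_terms (points K d) >] then
      functional (codes (limit x K d))
        (fun t => \big[addb/false]_(k <- iota 0 (K t)) g (d t k))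
      else false
  end.
have gS b : S b -> g b = e (ix b) by case: b => [n|x K d] Sb; rewrite [LHS]/= asboolT.
have gN x K d : ~ S (limit x K d) -> distinct_terms (points K d) ->
    functional (codes (limit x K d)) (fun t => ev g (points K d t)) = g (limit x K d).
  move=> nS dd; rewrite [RHS]/= (asboolF nS) (asboolT dd); congr functional.
  by apply/funext => t; rewrite /ev big_map.
exists g; last by rewrite (ev_ix e).
move=> x K d dd.
have [Sb|nSb] := pselect (S (limit x K d)); last first.
  exact: gN.
rewrite gS //; set n := ix _.
have sn : s n = limit x K d by exact: ixK.
have pS t i : (i < size (points K d t))%N -> S (nth (base 0) (points K d t) i).
  rewrite size_map size_iota => iK; rewrite (nth_map 0%N) ?size_iota//.
  exact: Schild Sb.
have sigE t : sigma n t = map ix (points K d t) by rewrite /sigma sn.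
rewrite -eP.
  rewrite [in RHS]/comp sn; congr functional; apply/funext => t.
  by rewrite sigE; exact: (ev_ix _ _ _ gS (pS t)).
move=> t t' /dd[e' e'tt']; exists (e' \o s).
have e's b : S b -> e' b = (e' \o s) (ix b) by move=> Sb'; rewrite /= ixK.
by rewrite !sigE -(ev_ix _ _ _ e's (pS t)) -(ev_ix _ _ _ e's (pS t')).
Qed.

(** * The group of admissible functions *)

(** A linear form on a space [V] of functions that depends only on the restriction to a
    finite list [F] is the sum of the values on a sublist of [F]. *)
Lemma finite_functional (T : Type) (F : seq T) (V : (T -> bool) -> Prop)
    (l : (T -> bool) -> bool) :
  (forall g g', V g -> V g' -> V (addf g g')) ->
  (forall g g', V g -> V g' -> l (addf g g') = l g (+) l g') ->
  (forall g, V g -> all (fun b => ~~ g b) F -> l g = false) ->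
  exists m : bitseq, forall g, V g -> l g = ev g (mask m F).
Proof.
move=> + lD; elim: F V lD => [|b F IH] V lD VD l0.
  by exists [::] => g Vg; rewrite /ev big_nil l0.
have [|||m mP] := IH (fun g => V g /\ g b = false).
- by move=> g g' [Vg _] [Vg' _]; exact: lD.
- by move=> g g' [Vg gb] [Vg' g'b]; split; [exact: VD|rewrite /addf gb g'b].
- by move=> g [Vg gb] gF; apply: l0 => //=; rewrite gb.
have [[n [Vn nb]]|none] := pselect (exists n, V n /\ n b); last first.
  exists (false :: m) => g Vg; apply: mP; split=> //.
  by apply/negbTE/negP => gb; apply: none; exists g.
exists ((l n (+) ev n (mask m F)) :: m) => g Vg.
have -> : ev g (mask ((l n (+) ev n (mask m F)) :: m) (b :: F)) =
    ((l n (+) ev n (mask m F)) && g b) (+) ev g (mask m F).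
  by rewrite /=; case: (_ (+) _); rewrite //= ev_cons.
case gb : (g b); last by rewrite andbF addFb; apply: mP.
have : l (addf g n) = ev (addf g n) (mask m F).
  by apply: mP; split; [exact: VD|rewrite /addf gb nb].
rewrite lD // ev_addf andbT; move: (l g) (l n) (ev g _) (ev n _).
by do 4 case.
Qed.

Definition admissible_pred : {pred index -> bool} := fun g => `[< admissible g >].

Lemma admissible_addf g g' : admissible g -> admissible g' -> admissible (addf g g').
Proof.
move=> ag ag' x K d dd.
rewrite (_ : (fun t => ev (addf g g') (points K d t)) =
  addf (fun t => ev g (points K d t)) (fun t => ev g' (points K d t))).
  by rewrite functional_additive ag // ag'.
by apply/funext => t; rewrite ev_addf.
Qed.

Lemma admissible0 : admissible (fun _ => false).
Proof.
move=> x K d _; rewrite (_ : (fun t => _) = fun _ => false) ?functional0//.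
by apply/funext => t; rewrite /ev big1.
Qed.

Lemma admissible_zmod_closed : zmod_closed admissible_pred.
Proof.
split; first by apply/asboolP; exact: admissible0.
by move=> g g' /asboolP ag /asboolP ag'; apply/asboolP; exact: admissible_addf.
Qed.

HB.instance Definition _ :=
  GRing.isZmodClosed.Build (index -> bool) admissible_pred admissible_zmod_closed.

(** The group [G], with the topology of pointwise convergence. *)
Record tree_group := TreeGroup {
  tree_val :> index -> bool; _ : tree_val \in admissible_pred }.

HB.instance Definition _ := [isSub for tree_val].
HB.instance Definition _ := [Choice of tree_group by <:].
HB.instance Definition _ := [SubChoice_isSubZmodule of tree_group by <:].

Definition agree (F : seq index) (g g' : tree_group) : bool :=
  all (fun b => g b == g' b) F.

Definition tree_nbhs (g : tree_group) : set (set tree_group) :=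
  [set A | exists F, forall g', agree F g g' -> A g'].

HB.instance Definition _ := hasNbhs.Build tree_group tree_nbhs.

Lemma agree_refl F g : agree F g g.
Proof. by elim: F => //= b F ->; rewrite eqxx. Qed.

Lemma agree_trans F g g' g'' : agree F g g' -> agree F g' g'' -> agree F g g''.
Proof. by elim: F => //= b F IH /andP[/eqP-> /IH h] /andP[-> /h]. Qed.

Lemma tree_nbhs_filter g : ProperFilter (tree_nbhs g).
Proof.
split; first by move=> [F /(_ g (agree_refl F g))].
split; first by exists [::].
  move=> A A' [F FA] [F' FA']; exists (F ++ F') => g'.
  by rewrite /agree all_cat => /andP[/FA ? /FA'].
by move=> A A' AA' [F FA]; exists F => g' /FA/AA'.
Qed.

Lemma tree_nbhs_singleton g (A : set tree_group) : tree_nbhs g A -> A g.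
Proof. by move=> [F]; apply; exact: agree_refl. Qed.

Lemma tree_nbhs_nbhs g (A : set tree_group) :
  tree_nbhs g A -> tree_nbhs g (tree_nbhs^~ A).
Proof.
move=> [F FA]; exists F => g' gg'; exists F => g'' g'g''.
by apply: FA; exact: agree_trans g'g''.
Qed.

HB.instance Definition _ := Nbhs_isNbhsTopological.Build tree_group
  tree_nbhs_filter tree_nbhs_singleton tree_nbhs_nbhs.

Lemma tree_subE (g g' : tree_group) b : (g - g')%R b = g b (+) g' b.
Proof. by []. Qed.

Lemma agree_sub F g1 g2 g1' g2' : agree F g1 g1' -> agree F g2 g2' ->
  agree F (g1 - g2)%R (g1' - g2')%R.
Proof.
elim: F => [//|b F IH] /andP[/eqP e1 /IH h] /andP[/eqP e2 /h h'].
by apply/andP; split => //; rewrite !tree_subE e1 e2.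
Qed.

Lemma tree_sub_continuous :
  continuous (fun x : tree_group * tree_group => (x.1 - x.2)%R).
Proof.
move=> [g g'] A /= [F FA].
exists ([set h | agree F g h], [set h | agree F g' h]); first by split; exists F.
by move=> [h h'] /= [gh gh']; apply: FA; exact: agree_sub.
Qed.

HB.instance Definition _ :=
  PreTopologicalNmodule_isTopologicalZmodule.Build tree_group tree_sub_continuous.

Lemma tree_separates (v : seq index) : (exists e, ev e v) ->
  exists g : tree_group, ev g v.
Proof.
move=> /admissible_separates[g ag gv].
by exists (TreeGroup (asboolT ag : g \in admissible_pred)).
Qed.

Lemma tree_separates2 b b' : (forall g : tree_group, g b = g b') -> b = b'.
Proof.
move=> bb'; apply: contrapT => nbb'.
have [|g] := @tree_separates [:: b; b'].
  exists (fun z => `[< z = b >]); rewrite ev_cons /ev big_seq1.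
  by rewrite (asboolT (erefl b)) asboolF // => /esym.
by rewrite ev_cons /ev big_seq1 bb' addbb.
Qed.

Lemma tree_hausdorff : hausdorff_space tree_group.
Proof.
move=> g g' gg'; apply/val_inj/funext => b.
have [h [/= gh g'h]] : [set h : tree_group | g b == h b] `&`
    [set h : tree_group | g' b == h b] !=set0.
  by apply: gg'; exists [:: b] => h /=; rewrite andbT.
by rewrite (eqP gh) (eqP g'h).
Qed.

Lemma tree_infinite : infinite_set [set: tree_group].
Proof.
move=> /finite_seqP[s sE].
pose f n : (size s).-tuple bool := map_tuple (fun g : tree_group => g (base n)) (in_tuple s).
apply: (@no_inj_nat_fin _ f) => m n /(congr1 val) /= /eq_in_map mn.
suff [] : base m = base n by [].
apply: tree_separates2 => g; apply: mn.
by have : [set: tree_group] g by []; rewrite sE.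
Qed.

Lemma tree_precompact : precompact_group tree_group.
Proof.
move=> U [F FU].
pose pat (g : tree_group) := map_tuple g (in_tuple F).
pose rep (p : (size F).-tuple bool) : tree_group :=
  if pselect (exists g, pat g = p) is left h then sval (cid h) else 0%R.
exists (range rep); first by apply: finite_image; exact: finite_finset.
apply/seteqP; split=> // g _.
exists (rep (pat g)); first by exists (pat g).
have rg : pat (rep (pat g)) = pat g.
  rewrite /rep; case: pselect => [h|]; first exact: (svalP (cid h)).
  by case; exists g.
exists (g - rep (pat g))%R; last by rewrite addrC subrK.
apply: FU; rewrite -(subrr g); apply: agree_sub; first exact: agree_refl.
move: rg => /(congr1 val) /=; elim: (F) => //= b F' IH [e /IH ->].
by rewrite e eqxx.
Qed.

(** * Infinite quotients have weight at least [2^c] *)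

Section LargeQuotient.
Variable N : zmodClosed tree_group.
Hypothesis N_closed : closed [set g : tree_group | g \in N].
Hypothesis N_infinite : infinite_set [set: quotient_group N].
Local Open Scope ring_scope.

(** The vector [h] is in the annihilator of [N]. *)
Definition annihilates (h : seq index) : Prop :=
  forall g : tree_group, g \in N -> ev g h = false.

Lemma tree_ev_sub (g g' : tree_group) h : ev (g - g') h = ev g h (+) ev g' h.
Proof. exact: ev_addf. Qed.

Lemma tree_sub_opp (g g' : tree_group) : g - g' = g' - g.
Proof. by apply/val_inj/funext => b; exact: addbC. Qed.

(** Finitely many vectors have a common kernel of finite index in [G], which is
    therefore not contained in [N]. *)
Lemma outside_kernel (hs : seq (seq index)) :
  exists2 g : tree_group, g \notin N & all (fun h => ~~ ev g h) hs.
Proof.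
apply: contrapT => none.
have KN (g : tree_group) : all (fun h => ~~ ev g h) hs -> g \in N.
  by move=> gh; apply: contrapT => /negP gN; apply: none; exists g.
apply: N_infinite.
pose f (q : quotient_group N) := map_tuple (ev (repr q)) (in_tuple hs).
apply: (@card_le_finite _ _ _ [set: (size hs).-tuple bool]); last exact: finite_finset.
apply/card_leqP; exists f => p q /(congr1 val) /= pq.
rewrite -[p]reprK -[q]reprK; apply/quot_eqP/KN.
elim: (hs) pq => //= h hs' IH [pq /IH ->].
by rewrite tree_ev_sub pq addbb.
Qed.

(** The annihilator of [N] has a vector outside any finite list: some [g0] not in [N]
    vanishes on the list, a finite list [F] of coordinates keeps [g0] away from the closed
    set [N], and the form with kernel [N] on the group generated by [N] and [g0] is a sum of
    coordinates in [F]. *)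
Lemma new_annihilator (hs : seq (seq index)) :
  exists2 h, annihilates h &
    exists g : tree_group, ev g h /\ all (fun h' => ~~ ev g h') hs.
Proof.
have [g0 g0N g0hs] := outside_kernel hs.
have [F FN] : exists F, forall g : tree_group, agree F g0 g -> g \notin N.
  have : open (~` [set g : tree_group | g \in N]) by rewrite openC.
  rewrite openE => /(_ g0); case; first exact/negP.
  by move=> F FN; exists F => g /FN/negP.
(* [V] is the group generated by [N] and [g0], and [l] its form with kernel [N]. *)
pose V (f : index -> bool) := exists g : tree_group,
  g = f :> (index -> bool) /\ (g \in N \/ g - g0 \in N).
pose l (f : index -> bool) := `[< ~ exists2 g : tree_group, g \in N & g = f :> (index -> bool) >].
have lN (g : tree_group) : l g = (g \notin N).
  apply/asboolP/idP => [ng|gN [g' g'N /val_inj gg']].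
    by apply/negP => gN; apply: ng; exists g.
  by rewrite -gg' g'N in gN.
have addE (g g' : tree_group) : addf g g' = (g - g' : tree_group) by [].
have swap (g g' : tree_group) : g - g0 \in N -> g' - g0 \in N -> g - g' \in N.
  move=> h h'; have -> : g - g' = (g - g0) - (g' - g0) by rewrite opprB addrA subrK.
  exact: rpredB.
have notN (g : tree_group) : g - g0 \in N -> g \notin N.
  move=> h; apply/negP => gN; move/negP: g0N; apply.
  by rewrite -(subKr g g0); exact: rpredB.
have mixed (g g' : tree_group) : g \in N -> g' - g0 \in N -> g - g' - g0 \in N.
  move=> gN h; rewrite (tree_sub_opp g g') addrAC; exact: rpredB.
have mixed' (g g' : tree_group) : g - g0 \in N -> g' \in N -> g - g' - g0 \in N.
  by move=> h gN; rewrite addrAC; exact: rpredB.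
have [|||m mP] := @finite_functional _ F V l.
- move=> _ _ [g [<- gV]] [g' [<- gV']]; rewrite addE; exists (g - g'); split=> //.
  case: gV gV' => [gN|gN] [gN'|gN'].
  + by left; exact: rpredB.
  + by right; exact: mixed.
  + by right; exact: mixed'.
  + by left; exact: swap.
- move=> _ _ [g [<- gV]] [g' [<- gV']]; rewrite addE !lN.
  case: gV gV' => [gN|gN] [gN'|gN'].
  + by rewrite gN gN' rpredB.
  + by rewrite gN (notN g') // notN //; exact: mixed.
  + by rewrite gN' (notN g) // notN //; exact: mixed'.
  + by rewrite (notN g) // (notN g') // swap.
- move=> _ [g [<- gV]] gF; rewrite lN; case: gV => [->//|gN].
  suff : g - g0 \notin N by rewrite gN.
  apply: FN; elim: (F) gF => [//|b F' IH] /andP[gb /IH gF'].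
  by apply/andP; split=> //; rewrite tree_subE (negbTE gb).
exists (mask m F).
  move=> g gN; rewrite -mP ?lN ?gN//.
  by exists g; split=> //; left.
exists g0; split=> //; rewrite -mP ?lN//.
by exists g0; split=> //; right; rewrite subrr rpred0.
Qed.

Lemma annihilator_sequence : exists D : nat -> seq index,
  (forall t, annihilates (D t)) /\ distinct_terms D.
Proof.
have stepP hs : exists h, annihilates h /\
    exists g : tree_group, ev g h /\ all (fun h' => ~~ ev g h') hs.
  by have [h h1 h2] := new_annihilator hs; exists h.
have [step {}stepP] := choice stepP.
pose S := fix S n := if n is n'.+1 then step (S n') :: S n' else [::].
exists (fun t => step (S t)); split=> [t|t t']; first by have [] := stepP (S t).
have lt_dist u w : (u < w)%N -> exists e : index -> bool, ev e (step (S u)) <> ev e (step (S w)).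
  move=> uw; have [_ [g [gw gS]]] := stepP (S w); exists g; rewrite gw.
  suff /negbTE-> : ~~ ev g (step (S u)) by [].
  elim: w uw gS {gw} => // w IH; rewrite ltnS leq_eqVlt /= => /orP[/eqP<-|uw] /andP[nu gw] //.
  exact: IH.
move=> /eqP; rewrite neq_ltn => /orP[/lt_dist//|/lt_dist[e ne]].
by exists e => /esym.
Qed.

Lemma many_characters : exists b : set continuum -> index,
  injective b /\ forall x (g : tree_group), g \in N -> g (b x) = false.
Proof.
have [D [DN dD]] := annihilator_sequence.
pose K t := size (D t); pose d t k := nth (base 0) (D t) k.
have DE : points K d = D by apply/funext => t; exact: mkseq_nth.
exists (fun x => limit x K d); split=> [x y []//|x g gN].
have ag : admissible g by apply/asboolP; exact: (valP g).
rewrite -ag DE //= (_ : (fun t => _) = fun _ => false) ?functional0//.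
by apply/funext => t; exact: DN.
Qed.

(** A character [g |-> g (b x)] is determined by a basic neighbourhood [U x] of 0 inside
    its kernel together with a sublist of the finitely many coordinates that control
    [U x]. *)
Lemma large_weight L : weight_at_most (quotient_group N) L -> emb (set continuum) L.
Proof.
move=> [w [[B0 [B0open B0basis] B0w] _] /card_leqP wL]; apply: emb_trans wL.
have [b [bI bN]] := many_characters.
pose pi (g : tree_group) : quotient_group N := \pi_(quotient_group N)%qT g.
pose O x : set (quotient_group N) :=
  [set q | (repr q : tree_group) (b x) = false].
have piO x g : O x (pi g) <-> g (b x) = false.
  have := bN x _ (repr_pi N g); rewrite tree_subE => /addb_inj e.
  by rewrite /O /= e.
have Oopen x : open (O x).
  suff : open (pi @^-1` O x) by [].
  rewrite openE => g /= /piO gx; exists [:: b x] => g' /=; rewrite andbT => /eqP gg'.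
  by apply/piO; rewrite -gg'.
have nbU x : exists U, [/\ B0 U, U (pi 0) & U `<=` O x].
  have [|U [BU U0] UO] := B0basis (pi 0) (O x); last by exists U.
  by apply: open_nbhs_nbhs; split=> //; apply/piO.
have [U UP] := choice nbU.
have nbF V : exists F, B0 V -> V (pi 0) -> forall g : tree_group, agree F 0 g -> V (pi g).
  have [[BV V0]|nV] := pselect (B0 V /\ V (pi 0)); last by exists [::] => ? ?; case: nV.
  have : open (pi @^-1` V) by exact: B0open.
  by rewrite openE => /(_ 0 V0)[F FV]; exists F.
have [F FP] := choice nbF.
have mex x : exists m : bitseq, forall g : tree_group, g (b x) = ev g (mask m (F (U x))).
  have [BU U0 UO] := UP x.
  have [|||m mP] := @finite_functional _ (F (U x))
    (fun f => exists g : tree_group, g = f :> (index -> bool))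
    (fun f => f (b x)).
  - by move=> _ _ [g <-] [g' <-]; exists (g - g').
  - by [].
  - move=> _ [g <-] gF; apply/piO/UO; apply: (FP (U x)) => //.
  by exists m => g; apply: mP; exists g.
have [m mP] := choice mex.
have B0w' : emb B0 w.
  move: B0w => /card_eqPle[/card_le_emb h _].
  exact: emb_trans h (set_type_setT w).2.
have big : emb (set continuum) (w * nat).
  apply: emb_trans (emb_prod B0w' (emb_count bitseq)).
  have BU x : B0 (U x) by have [] := UP x.
  exists (fun x => (SigSub (mem_set (BU x)) : B0, m x)) => x y [eU em].
  by apply/bI/tree_separates2 => g; rewrite (mP x) (mP y) em eU.
have [nw|wn] := emb_total nat w; first exact: emb_trans big (emb_prod_nat nw).
exfalso; apply: (@cantor nat).
apply: emb_trans (emb_bool_set nat).1 _.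
apply: (@emb_trans (set continuum)); first by
  exists (fun c => [set c]) => c c' /seteqP[/(_ c erefl)].
apply: emb_trans big _; apply: emb_trans (emb_prod wn _) (emb_count _).
by exists id.
Qed.

End LargeQuotient.

Theorem theorem2p6 :
  is_weak_pow2 continuum continuum -> is_frak_n (card_pow2 continuum).
Proof.
move=> _; split=> [G HG Ginf Gpre|L PL].
  have [N [Ncl Ninf Ncard]] := infinite_small_quotient HG Ginf Gpre.
  exists N; split=> //; apply: weight_exists; exact: emb_set.
have [N [Ncl Ninf NL]] := PL _ tree_hausdorff tree_infinite tree_precompact.
by apply/card_leqP; exact: large_weight NL.
Qed.
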